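(* Let $(M^{2d+1},\Omega,\alpha,g)$ be a co-Kähler manifold, let $(\nabla,\nabla^* )$ be a statistical shs connection on it, and for $a\in\mathbb{R}$ put $\nabla^{a}=\frac{1+a}{2}\nabla^{*}+\frac{1-a}{2}\nabla$. Then: (1) the leaves of the foliation $\ell_\Omega=\ker\Omega$ are totally geodesic with respect to $\nabla^{a}$ for all $a\in\mathbb{R}$; (2) the leaves of the foliation $\ell_\alpha=\ker\alpha$ are totally geodesic with respect to $\nabla^{a}$ for all $a\in\mathbb{R}$.
   Context: A co-Kähler manifold is $(M^{2d+1},\Omega,\alpha)$ with $\Omega$ a closed 2-form, $\alpha$ a closed 1-form, $\alpha\wedge\Omega^d$ nowhere zero, admitting a compatible almost contact metric structure $(\Theta,E,\alpha,g)$ with $N^{\Theta}=0$. Here $E$ is the Reeb vector field ($i_E\Omega=0$, $i_E\alpha=1$); $\Theta$ is an endomorphism field of $TM$ and $g$ a Riemannian metric with $\Theta^2=-I+\alpha\otimes E$, $\Theta E=0$, $\alpha\circ\Theta=0$, $\alpha=g(\cdot,E)$, $g=\Omega(\cdot,\Theta\cdot)+\alpha\otimes\alpha$; and $N^{\Theta}(X,Y)=[\Theta X,\Theta Y]-\Theta[\Theta X,Y]-\Theta[X,\Theta Y]+\Theta^2[X,Y]$. The metric $g$ is called the co-Kähler metric. A statistical shs connection is a pair $(\nabla,\nabla^* )$ of torsion-free linear connections, dual with respect to $g$, i.e. $X\,g(Y,Z)=g(\nabla_XY,Z)+g(Y,\nabla^*_XZ)$, with $\nabla E=0$ and $\nabla\Omega=0$.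 (The real parameter, denoted $\alpha$ in the $\alpha$-connection terminology of information geometry, is written $a$ here to distinguish it from the 1-form $\alpha$.) *)

(* Defs.v *)
From HB Require Import structures.
From mathcomp Require Import all_boot all_order all_algebra perm.
From mathcomp Require Import all_classical all_reals all_analysis.

Set Implicit Arguments.
Unset Strict Implicit.
Unset Printing Implicit Defensive.

Import Order.TTheory GRing.Theory Num.Theory numFieldNormedType.Exports.
Local Open Scope classical_set_scope.
Local Open Scope ring_scope.

(** * Smooth functions on open subsets of R^n *)

Fixpoint Ck_on (R : realType) (n k : nat) (U : set 'rV[R]_n)
    (f : 'rV[R]_n -> R) : Prop :=
  (forall x, U x -> {for x, continuous f}) /\
  if k is k'.+1 then
    forall i : 'I_n,
      (forall x, U x -> derivable f x (delta_mx 0 i)) /\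
      Ck_on k' U (fun x => 'D_(delta_mx 0 i) f x)
  else True.

Definition Cinfty_on (R : realType) (n : nat) (U : set 'rV[R]_n)
    (f : 'rV[R]_n -> R) : Prop := forall k, Ck_on k U f.

(** * Smooth manifolds *)

(* [chart_inv] is only meaningful on the open set [chart_map @` chart_dom]. *)
Record chart (R : realType) (n : nat) (T : Type) := Chart {
  chart_dom : set T;
  chart_map : T -> 'rV[R]_n;
  chart_inv : 'rV[R]_n -> T }.

Definition chart_img (R : realType) (n : nat) (T : Type) (c : chart R n T) :
  set 'rV[R]_n := chart_map c @` chart_dom c.

Definition is_chart (R : realType) (n : nat) (T : topologicalType)
    (c : chart R n T) : Prop :=
  [/\ open (chart_dom c),
      open (chart_img c),
      forall x, chart_dom c x -> chart_inv c (chart_map c x) = x,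
      forall x, chart_dom c x -> {for x, continuous (chart_map c)} &
      forall y, chart_img c y -> {for y, continuous (chart_inv c)}].

Definition smooth_transition (R : realType) (n : nat) (T : Type)
    (c c' : chart R n T) : Prop :=
  forall i : 'I_n,
    Cinfty_on (chart_map c @` (chart_dom c `&` chart_dom c'))
      (fun y => chart_map c' (chart_inv c y) 0 i).

Record smoothManifold (R : realType) (n : nat) := SmoothManifold {
  points :> topologicalType;
  atlas : set (chart R n points);
  points_hausdorff : hausdorff_space points;
  points_second_countable : @second_countable points;
  atlas_chart : forall c, atlas c -> is_chart c;
  atlas_cover : forall x : points, exists2 c, atlas c & chart_dom c x;
  atlas_compat : forall c c', atlas c -> atlas c' -> smooth_transition c c' }.

Definition smooth_on (R : realType) (n : nat) (M : smoothManifold R n)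
    (W : set M) (f : M -> R) : Prop :=
  forall c, atlas c ->
    Cinfty_on (chart_map c @` (chart_dom c `&` W)) (f \o chart_inv c).

Definition smooth_at (R : realType) (n : nat) (M : smoothManifold R n)
    (p : M) (f : M -> R) : Prop :=
  exists2 W : set M, open_nbhs p W & smooth_on W f.

(* Abbreviations for raw types; that a raw object is a tangent vector, a
   vector field, a form, a connection etc. is asserted by the predicates
   below. *)
Notation functional R M := ((M -> R) -> R) (only parsing).
Notation vfield R M := (M -> functional R M) (only parsing).
Notation tensor1 R M := (M -> functional R M -> R) (only parsing).
Notation tensor2 R M := (M -> functional R M -> functional R M -> R)
  (only parsing).
Notation tensor11 R M := (M -> functional R M -> functional R M)
  (only parsing).
Notation connection R M := (vfield R M -> vfield R M -> vfield R M)
  (only parsing).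

(** * Tangent vectors and vector fields *)

(* A tangent vector at [p] is a derivation of the algebra of germs at [p] of
   smooth functions. It is represented as a functional on all functions
   [M -> R] which only depends on the germ at [p] and which takes the
   conventional value 0 on functions that are not smooth near [p], so that
   Leibniz equality of functionals is equality of tangent vectors. The vector
   space operations are the pointwise ones. *)
Definition tangent (R : realType) (n : nat) (M : smoothManifold R n) (p : M) :
    set (functional R M) :=
  [set v | [/\ forall f g, (\forall q \near p, f q = g q) -> v f = v g,
               forall f, ~ smooth_at p f -> v f = 0,
               forall (a : R) f g, smooth_at p f -> smooth_at p g ->
                 v (fun q => a * f q + g q) = a * v f + v g &
               forall f g, smooth_at p f -> smooth_at p g ->
                 v (fun q => f q * g q) = v f * g p + f p * v g]].

(* Enforces the convention of [tangent] on functions not smooth near [p]. *)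
Definition restrict_smooth (R : realType) (n : nat) (M : smoothManifold R n)
    (p : M) (v : functional R M) : functional R M :=
  fun f => if `[< smooth_at p f >] then v f else 0.

Definition vector_field (R : realType) (n : nat) (M : smoothManifold R n)
    (X : vfield R M) : Prop :=
  (forall p, tangent p (X p)) /\
  (forall (W : set M) f, open W -> smooth_on W f ->
    smooth_on W (fun p => X p f)).

Definition lie_bracket (R : realType) (n : nat) (M : smoothManifold R n)
    (X Y : vfield R M) : vfield R M :=
  fun p => restrict_smooth p
    (fun f => X p (fun q => Y q f) - Y p (fun q => X q f)).

(** * Tensor fields, given by their values on tangent spaces *)

Definition one_form (R : realType) (n : nat) (M : smoothManifold R n)
    (alpha : tensor1 R M) : Prop :=
  (forall p (a : R) v w, tangent p v -> tangent p w ->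
    alpha p (a *: v + w) = a * alpha p v + alpha p w) /\
  (forall X, vector_field X -> smooth_on setT (fun p => alpha p (X p))).

Definition bilinear_field (R : realType) (n : nat) (M : smoothManifold R n)
    (B : tensor2 R M) : Prop :=
  [/\ forall p (a : R) u v w, tangent p u -> tangent p v -> tangent p w ->
        B p (a *: u + v) w = a * B p u w + B p v w,
      forall p (a : R) u v w, tangent p u -> tangent p v -> tangent p w ->
        B p u (a *: v + w) = a * B p u v + B p u w &
      forall X Y, vector_field X -> vector_field Y ->
        smooth_on setT (fun p => B p (X p) (Y p))].

Definition two_form (R : realType) (n : nat) (M : smoothManifold R n)
    (Omega : tensor2 R M) : Prop :=
  bilinear_field Omega /\
  (forall p v, tangent p v -> Omega p v v = 0).

Definition riemannian_metric (R : realType) (n : nat)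
    (M : smoothManifold R n)
    (g : tensor2 R M) : Prop :=
  [/\ bilinear_field g,
      forall p v w, tangent p v -> tangent p w -> g p v w = g p w v &
      forall p v, tangent p v -> v <> 0 -> 0 < g p v v].

Definition endomorphism_field (R : realType) (n : nat)
    (M : smoothManifold R n)
    (Theta : tensor11 R M) : Prop :=
  [/\ forall p v, tangent p v -> tangent p (Theta p v),
      forall p (a : R) v w, tangent p v -> tangent p w ->
        Theta p (a *: v + w) = a *: Theta p v + Theta p w &
      forall X, vector_field X -> vector_field (fun p => Theta p (X p))].

(* Exterior derivatives are given by Cartan's (Koszul's) formula. *)
Definition ext_deriv1 (R : realType) (n : nat) (M : smoothManifold R n)
    (alpha : tensor1 R M) (X Y : vfield R M) (p : M) : R :=
  X p (fun q => alpha q (Y q)) - Y p (fun q => alpha q (X q))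
  - alpha p (lie_bracket X Y p).

Definition ext_deriv2 (R : realType) (n : nat) (M : smoothManifold R n)
    (Omega : tensor2 R M)
    (X Y Z : vfield R M) (p : M) : R :=
  X p (fun q => Omega q (Y q) (Z q)) - Y p (fun q => Omega q (X q) (Z q))
  + Z p (fun q => Omega q (X q) (Y q))
  - Omega p (lie_bracket X Y p) (Z p) + Omega p (lie_bracket X Z p) (Y p)
  - Omega p (lie_bracket Y Z p) (X p).

Definition closed1 (R : realType) (n : nat) (M : smoothManifold R n)
    (alpha : tensor1 R M) : Prop :=
  forall X Y, vector_field X -> vector_field Y ->
    forall p, ext_deriv1 alpha X Y p = 0.

Definition closed2 (R : realType) (n : nat) (M : smoothManifold R n)
    (Omega : tensor2 R M) : Prop :=
  forall X Y Z, vector_field X -> vector_field Y -> vector_field Z ->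
    forall p, ext_deriv2 Omega X Y Z p = 0.

(* The (2d+1)-form alpha /\ Omega^d; the factor 1 / 2^d is 1 / (1! (2!)^d). *)
Definition wedge_alpha_Omega (R : realType) (d : nat)
    (M : smoothManifold R d.*2.+1)
    (Omega : tensor2 R M)
    (alpha : tensor1 R M) (p : M)
    (v : 'I_d.*2.+1 -> functional R M) : R :=
  (2 ^+ d)^-1 *
  \sum_(s : {perm 'I_d.*2.+1}) (-1) ^+ s * alpha p (v (s ord0)) *
    \prod_(i < d) Omega p (v (s (inord i.*2.+1))) (v (s (inord i.*2.+2))).

(** * Co-Kähler structures *)

Definition cosymplectic (R : realType) (d : nat)
    (M : smoothManifold R d.*2.+1)
    (Omega : tensor2 R M)
    (alpha : tensor1 R M) : Prop :=
  [/\ two_form Omega, one_form alpha, closed2 Omega, closed1 alpha &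
      forall p, exists2 v : 'I_d.*2.+1 -> functional R M,
        forall i, tangent p (v i) & wedge_alpha_Omega Omega alpha p v <> 0].

Definition reeb (R : realType) (n : nat) (M : smoothManifold R n)
    (Omega : tensor2 R M)
    (alpha : tensor1 R M) (E : vfield R M) : Prop :=
  [/\ vector_field E,
      forall p v, tangent p v -> Omega p (E p) v = 0 &
      forall p, alpha p (E p) = 1].

Definition almost_contact_metric (R : realType) (n : nat)
    (M : smoothManifold R n)
    (Theta : tensor11 R M)
    (E : vfield R M) (alpha : tensor1 R M)
    (Omega g : tensor2 R M) : Prop :=
  [/\ endomorphism_field Theta /\ riemannian_metric g,
      forall p v, tangent p v ->
        Theta p (Theta p v) = - v + alpha p v *: E p,
      forall p, Theta p (E p) = 0,
      forall p v, tangent p v ->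
        alpha p (Theta p v) = 0 /\ alpha p v = g p v (E p) &
      forall p v w, tangent p v -> tangent p w ->
        g p v w = Omega p v (Theta p w) + alpha p v * alpha p w].

Definition nijenhuis (R : realType) (n : nat) (M : smoothManifold R n)
    (Theta : tensor11 R M)
    (X Y : vfield R M) : vfield R M :=
  let TX := fun p => Theta p (X p) in
  let TY := fun p => Theta p (Y p) in
  fun p => lie_bracket TX TY p - Theta p (lie_bracket TX Y p)
    - Theta p (lie_bracket X TY p) + Theta p (Theta p (lie_bracket X Y p)).

(* [g] is the co-Kähler metric and [E] the Reeb vector field. *)
Definition coKahler (R : realType) (d : nat) (M : smoothManifold R d.*2.+1)
    (Omega : tensor2 R M)
    (alpha : tensor1 R M) (E : vfield R M)
    (g : tensor2 R M) : Prop :=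
  [/\ cosymplectic Omega alpha, reeb Omega alpha E &
      exists2 Theta : tensor11 R M,
        almost_contact_metric Theta E alpha Omega g &
        forall X Y, vector_field X -> vector_field Y ->
          forall p, nijenhuis Theta X Y p = 0].

(** * Linear connections *)

Definition linear_connection (R : realType) (n : nat) (M : smoothManifold R n)
    (nabla : connection R M) : Prop :=
  [/\ forall X Y, vector_field X -> vector_field Y ->
        vector_field (nabla X Y),
      forall f X X' Y, smooth_on setT f ->
        vector_field X -> vector_field X' -> vector_field Y ->
        forall p, nabla (fun q => f q *: X q + X' q) Y p
                  = f p *: nabla X Y p + nabla X' Y p,
      forall X Y Y', vector_field X -> vector_field Y -> vector_field Y' ->
        forall p, nabla X (fun q => Y q + Y' q) p
                  = nabla X Y p + nabla X Y' p &
      forall f X Y, smooth_on setT f -> vector_field X -> vector_field Y ->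
        forall p, nabla X (fun q => f q *: Y q) p
                  = X p f *: Y p + f p *: nabla X Y p].

Definition torsion_free (R : realType) (n : nat) (M : smoothManifold R n)
    (nabla : connection R M) : Prop :=
  forall X Y, vector_field X -> vector_field Y ->
    forall p, nabla X Y p - nabla Y X p = lie_bracket X Y p.

Definition dual_connections (R : realType) (n : nat) (M : smoothManifold R n)
    (g : tensor2 R M)
    (nabla nablas : connection R M) : Prop :=
  forall X Y Z, vector_field X -> vector_field Y -> vector_field Z ->
    forall p, X p (fun q => g q (Y q) (Z q))
              = g p (nabla X Y p) (Z p) + g p (Y p) (nablas X Z p).

Definition parallel_field (R : realType) (n : nat) (M : smoothManifold R n)
    (nabla : connection R M) (E : vfield R M) : Prop :=
  forall X, vector_field X -> forall p, nabla X E p = 0.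

Definition parallel_two_form (R : realType) (n : nat)
    (M : smoothManifold R n)
    (nabla : connection R M)
    (Omega : tensor2 R M) : Prop :=
  forall X Y Z, vector_field X -> vector_field Y -> vector_field Z ->
    forall p, X p (fun q => Omega q (Y q) (Z q))
              - Omega p (nabla X Y p) (Z p) - Omega p (Y p) (nabla X Z p) = 0.

Definition statistical_shs (R : realType) (n : nat) (M : smoothManifold R n)
    (Omega : tensor2 R M)
    (E : vfield R M)
    (g : tensor2 R M)
    (nabla nablas : connection R M) : Prop :=
  [/\ linear_connection nabla /\ torsion_free nabla,
      linear_connection nablas /\ torsion_free nablas,
      dual_connections g nabla nablas,
      parallel_field nabla E &
      parallel_two_form nabla Omega].

Definition alpha_connection (R : realType) (n : nat) (M : smoothManifold R n)
    (nabla nablas : connection R M) (a : R) : connection R M :=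
  fun X Y p => ((1 + a) / 2) *: nablas X Y p + ((1 - a) / 2) *: nabla X Y p.

(** * Foliations and their leaves *)

Definition ker_one_form (R : realType) (n : nat) (M : smoothManifold R n)
    (alpha : tensor1 R M) (p : M) : set (functional R M) :=
  [set v | tangent p v /\ alpha p v = 0].

Definition ker_two_form (R : realType) (n : nat) (M : smoothManifold R n)
    (Omega : tensor2 R M) (p : M) : set (functional R M) :=
  [set v | tangent p v /\ forall w, tangent p w -> Omega p v w = 0].

Definition smooth_map (R : realType) (k n : nat) (L : smoothManifold R k)
    (M : smoothManifold R n) (i : L -> M) : Prop :=
  continuous i /\
  (forall q f, smooth_at (i q) f -> smooth_at q (f \o i)).

Definition differential (R : realType) (k n : nat) (L : smoothManifold R k)
    (M : smoothManifold R n) (i : L -> M) (q : L) (v : functional R L) :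
    functional R M :=
  restrict_smooth (i q) (fun f => v (f \o i)).

Definition image_tangent (R : realType) (k n : nat) (L : smoothManifold R k)
    (M : smoothManifold R n) (i : L -> M) (q : L) : set (functional R M) :=
  differential i q @` tangent q.

Definition injective_immersion (R : realType) (k n : nat)
    (L : smoothManifold R k) (M : smoothManifold R n) (i : L -> M) : Prop :=
  [/\ smooth_map i, injective i &
      forall q v w, tangent q v -> tangent q w ->
        differential i q v = differential i q w -> v = w].

Definition integral_manifold (R : realType) (k n : nat)
    (L : smoothManifold R k) (M : smoothManifold R n)
    (D : forall p : M, set (functional R M)) (i : L -> M) : Prop :=
  [/\ [set: L] !=set0, connected [set: L], injective_immersion i &
      forall q, image_tangent i q = D (i q)].

(* A leaf is a maximal connected (injectively immersed) integral manifold. Its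
   dimension [k] is forced to be the rank of [D] by the immersion condition. *)
Definition leaf (R : realType) (k n : nat)
    (L : smoothManifold R k) (M : smoothManifold R n)
    (D : forall p : M, set (functional R M)) (i : L -> M) : Prop :=
  integral_manifold D i /\
  (forall (k' : nat) (L' : smoothManifold R k') (j : L' -> M),
    integral_manifold D j -> range i `&` range j !=set0 ->
    range j `<=` range i).

(* An immersed submanifold is totally geodesic when the covariant derivative
   of fields tangent to it is tangent to it. Fields on the submanifold are
   taken near [q] only and extended to [M]; for an immersion, such local
   extensions always exist. *)
Definition totally_geodesic (R : realType) (k n : nat)
    (L : smoothManifold R k) (M : smoothManifold R n)
    (nabla : connection R M) (i : L -> M) : Prop :=
  forall X Y, vector_field X -> vector_field Y ->
    forall q : L,
      (\forall q' \near q, image_tangent i q' (X (i q')) /\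
                           image_tangent i q' (Y (i q'))) ->
      image_tangent i q (nabla X Y (i q)).

Definition leaves_totally_geodesic (R : realType) (n : nat)
    (M : smoothManifold R n)
    (nabla : connection R M)
    (D : forall p : M, set (functional R M)) : Prop :=
  forall (k : nat) (L : smoothManifold R k) (i : L -> M),
    leaf D i -> totally_geodesic nabla i.

(* Main.v *)
Require Import Defs.
From mathcomp Require Import all_boot all_order all_algebra perm.
From mathcomp Require Import all_classical all_reals all_analysis.
From mathcomp Require Import ring lra.

(** Everything reduces to the fact that the 1-form [alpha] is parallel for both
    connections: [X (alpha Y) = alpha (nabla X Y) = alpha (nablas X Y)].

    For [nablas] this is duality applied to [E] and [Y], because
    [alpha = g (., E)] and [nabla E = 0] ([nablas_parallel_alpha]). For [nabla],
    let [K = nablas - nabla], a symmetric tensor because both connections are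
    torsion-free, and let [C X Y Z = g Y (K X Z) = (nabla_X g) (Y, Z)], which is
    then totally symmetric. Hence [g E (K X Y) = C E X Y = (nabla_E g) (X, Y)],
    and it suffices that [nabla_E g = 0] ([nabla_reeb_metric]). Now
    [g = Omega (., Theta .) + alpha (x) alpha], where [nabla_E Omega = 0] by
    hypothesis. Since [nabla E = 0] and there is no torsion, [nabla_E] is the
    bracket with [E]; so [nabla_E alpha = 0] is the closedness of [alpha], and
    [N E X = 0] says that [Theta] kills [(nabla_E Theta) X], which is therefore
    a multiple of [E] and is invisible to [Omega].

    Once [alpha] is parallel, let [X], [Y] be tangent to a leaf. For
    [ker alpha], the function [alpha Y] vanishes along the leaf, so
    [alpha (nabla X Y) = X (alpha Y) = 0]. For [ker Omega], which is spanned by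
    [E], one has [Y = alpha Y *: E] along the leaf, and duality gives
    [g (nabla X Y) Z = X (alpha Y * alpha Z) - alpha Y * X (alpha Z)
    = alpha (nabla X Y) * alpha Z] there, for every field [Z]. Taking for [Z]
    the field [nabla X Y] itself, rather than an extension of an arbitrary
    vector, gives the equality case of Cauchy-Schwarz against the unit vector
    [E], so [nabla X Y] is a multiple of [E] ([reeb_direction]). The argument is
    the same for [nablas], and the kernels are linear spaces. *)

Set Implicit Arguments.
Unset Strict Implicit.
Unset Printing Implicit Defensive.

Import Order.TTheory GRing.Theory Num.Theory numFieldNormedType.Exports.
Local Open Scope classical_set_scope.
Local Open Scope ring_scope.

(** * Tangent vectors as derivations *)

Lemma smooth_on_at (R : realType) (n : nat) (M : smoothManifold R n) (p : M)
    (f : M -> R) : smooth_on setT f -> smooth_at p f.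
Proof. by move=> sf; exists setT => //; split=> //; exact: openT. Qed.

(** For [f] smooth near [p] this is linearity, [f] having the same germ as
    [f + f]; otherwise it is the convention built into [tangent]. *)
Lemma tangent_near0 (R : realType) (n : nat) (M : smoothManifold R n) (p : M)
    (v : functional R M) (f : M -> R) :
  tangent p v -> (\forall q \near p, f q = 0) -> v f = 0.
Proof.
move=> [germ nsm lin _] f0.
have [sf|/nsm //] := pselect (smooth_at p f).
have dbl : v (fun q => 1 * f q + f q) = v f.
  by apply: germ; near=> q; rewrite (_ : f q = 0) ?mulr0 ?addr0 //; near: q.
by move: dbl; rewrite lin // => dbl; lra.
Unshelve. all: by end_near. Qed.

Lemma tangent_const (R : realType) (n : nat) (M : smoothManifold R n) (p : M)
    (v : functional R M) (f : M -> R) :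
  tangent p v -> (forall q, f q = 1) -> smooth_at p f -> v f = 0.
Proof.
move=> [_ _ _ leib] f1 sf; have := leib f f sf sf.
rewrite (_ : (fun q => f q * f q) = f).
  by rewrite f1; lra.
by apply/funext => q; rewrite f1 mulr1.
Qed.

Lemma tangent_lincomb (R : realType) (n : nat) (M : smoothManifold R n)
    (p : M) (a : R) (v w : functional R M) :
  tangent p v -> tangent p w -> tangent p (a *: v + w).
Proof.
move=> [gv nv lv mv] [gw nw lw mw].
have E f : (a *: v + w) f = a * v f + w f by [].
split=> [f h fh|f nf|b f h sf sh|f h sf sh]; rewrite !E.
- by rewrite (gv f h) // (gw f h).
- by rewrite nv // nw // mulr0 addr0.
- by rewrite lv // lw //; ring.
- by rewrite mv // mw //; ring.
Qed.

Lemma tangent0 (R : realType) (n : nat) (M : smoothManifold R n) (p : M) :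
  tangent p (0 : functional R M).
Proof.
have E f : (0 : functional R M) f = 0 by [].
by split=> *; rewrite !E //; ring.
Qed.

Lemma tangentZ (R : realType) (n : nat) (M : smoothManifold R n) (p : M)
    (a : R) (v : functional R M) : tangent p v -> tangent p (a *: v).
Proof.
move=> tv; rewrite -[a *: v]addr0; apply: tangent_lincomb => //.
exact: tangent0.
Qed.

Lemma lie_bracket0l (R : realType) (n : nat) (M : smoothManifold R n)
    (X Y : vfield R M) (p : M) :
  vector_field Y -> (forall q, X q = 0) -> lie_bracket X Y p = 0.
Proof.
move=> [tY _] X0; apply/funext => f; rewrite /lie_bracket /restrict_smooth.
case: asboolP => // _; rewrite X0 (tangent_near0 (tY p)) ?subr0 //.
by near=> q; rewrite X0.
Unshelve. all: by end_near. Qed.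

Lemma bilinear0l (R : realType) (n : nat) (M : smoothManifold R n)
    (B : tensor2 R M) (p : M) (w : functional R M) :
  bilinear_field B -> tangent p w -> B p 0 w = 0.
Proof.
move=> [Bl _ _] tw; have := Bl p 1 0 0 w (tangent0 p) (tangent0 p) tw.
by rewrite scale1r addr0 => h; lra.
Qed.

Lemma bilinearZl (R : realType) (n : nat) (M : smoothManifold R n)
    (B : tensor2 R M) (p : M) (a : R) (v w : functional R M) :
  bilinear_field B -> tangent p v -> tangent p w ->
  B p (a *: v) w = a * B p v w.
Proof.
move=> Bbil tv tw; have [Bl _ _] := Bbil.
by rewrite -[a *: v]addr0 Bl ?bilinear0l ?addr0 //; exact: tangent0.
Qed.

Lemma bilinear0r (R : realType) (n : nat) (M : smoothManifold R n)
    (B : tensor2 R M) (p : M) (v : functional R M) :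
  bilinear_field B -> tangent p v -> B p v 0 = 0.
Proof.
move=> [_ Br _] tv; have := Br p 1 v 0 0 tv (tangent0 p) (tangent0 p).
by rewrite scale1r addr0 => h; lra.
Qed.

Lemma bilinearBr (R : realType) (n : nat) (M : smoothManifold R n)
    (B : tensor2 R M) (p : M) (u v w : functional R M) :
  bilinear_field B -> tangent p u -> tangent p v -> tangent p w ->
  B p u (v - w) = B p u v - B p u w.
Proof.
move=> [_ Br _] tu tv tw.
by rewrite addrC -scaleN1r Br // mulN1r addrC.
Qed.

(** * Pointwise algebra of the co-Kähler metric *)

Lemma alpha_reeb (R : realType) (n : nat) (M : smoothManifold R n)
    (Theta : tensor11 R M) (E : vfield R M) (alpha : tensor1 R M)
    (Omega g : tensor2 R M) (p : M) (v : functional R M) :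
  almost_contact_metric Theta E alpha Omega g -> tangent p v ->
  alpha p v = g p v (E p).
Proof. by move=> [_ _ _ Ha _] /Ha[]. Qed.

(** The hypothesis is the equality case of Cauchy-Schwarz between [u] and the
    unit vector [E p]: the component of [u] orthogonal to [E p] has norm 0. *)
Lemma reeb_direction (R : realType) (n : nat) (M : smoothManifold R n)
    (Theta : tensor11 R M) (E : vfield R M) (alpha : tensor1 R M)
    (Omega g : tensor2 R M) (p : M) (u : functional R M) :
  reeb Omega alpha E -> almost_contact_metric Theta E alpha Omega g ->
  tangent p u -> g p u u = alpha p u * alpha p u -> u = alpha p u *: E p.
Proof.
move=> [[tE _] _ aE] acm tu guu.
have [[_ [[gl gr _] gsym gpos]] _ _ _ _] := acm.
have aEg v : tangent p v -> alpha p v = g p v (E p) by exact: (alpha_reeb acm).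
have tEp := tE p.
set u' : functional R M := (- alpha p u) *: E p + u.
have tu' : tangent p u' by exact: tangent_lincomb.
suff u'0 : u' = 0.
  by apply/eqP; rewrite -subr_eq0 addrC -scaleNr; apply/eqP.
apply: contrapT => /(gpos p u' tu').
rewrite {1}/u' gl // /u' !gr // guu (gsym p (E p) u) // -!aEg // aE.
by move=> h; exfalso; lra.
Qed.

(** [Omega v = 0] gives [g v v = alpha v ^ 2] through the formula for [g]. *)
Lemma ker_two_form_reeb (R : realType) (n : nat) (M : smoothManifold R n)
    (Theta : tensor11 R M) (E : vfield R M) (alpha : tensor1 R M)
    (Omega g : tensor2 R M) (p : M) (v : functional R M) :
  reeb Omega alpha E -> almost_contact_metric Theta E alpha Omega g ->
  ker_two_form Omega p v -> v = alpha p v *: E p.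
Proof.
move=> rE acm [tv Ov]; apply: (reeb_direction rE acm tv).
have [[[tT _ _] _] _ _ _ gE] := acm.
by rewrite gE // Ov ?add0r //; exact: tT.
Qed.

(** The kernel of [Theta] is spanned by [E], which [Omega] annihilates. *)
Lemma Omega_ker_Theta (R : realType) (n : nat) (M : smoothManifold R n)
    (Theta : tensor11 R M) (E : vfield R M) (alpha : tensor1 R M)
    (Omega g : tensor2 R M) (p : M) (u w : functional R M) :
  two_form Omega -> reeb Omega alpha E ->
  almost_contact_metric Theta E alpha Omega g ->
  tangent p u -> tangent p w -> Theta p w = 0 -> Omega p u w = 0.
Proof.
move=> [Obil Oalt] [[tE _] OE aE] acm tu tw Tw.
have [_ T2 TE _ _] := acm; have [Ol Or _] := Obil.
have tEp := tE p; have t0 := tangent0 p.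
have T0 : Theta p 0 = 0.
  by have := T2 p (E p) tEp; rewrite TE aE scale1r addNr.
have wE : w = alpha p w *: E p + 0.
  have := T2 p w tw; rewrite Tw T0 addr0 => /esym/eqP.
  by rewrite addrC subr_eq0 => /eqP.
have OuE : Omega p u (E p) = 0.
  have tuE : tangent p (1 *: u + E p) by exact: tangent_lincomb.
  have := Oalt p _ tuE.
  by rewrite Ol // !Or // (OE p u) // !Oalt // => h; lra.
by rewrite wE Or // OuE bilinear0r // mulr0 addr0.
Qed.

(** * Parallelism of the 1-form *)

Definition parallel_one_form (R : realType) (n : nat) (M : smoothManifold R n)
    (nabla : connection R M) (alpha : tensor1 R M) : Prop :=
  forall X Y, vector_field X -> vector_field Y ->
    forall p, X p (fun q => alpha q (Y q)) = alpha p (nabla X Y p).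

Lemma dual_connections_sym (R : realType) (n : nat) (M : smoothManifold R n)
    (g : tensor2 R M) (nabla nablas : connection R M) :
  riemannian_metric g -> linear_connection nabla -> linear_connection nablas ->
  dual_connections g nabla nablas -> dual_connections g nablas nabla.
Proof.
move=> [_ gsym _] [tn _ _ _] [ts _ _ _] dual X Y Z vX vY vZ p.
have [tY tZ] := (vY.1, vZ.1).
rewrite (_ : (fun q => g q (Y q) (Z q)) = fun q => g q (Z q) (Y q)).
  rewrite dual // addrC gsym //; last exact: (ts _ _ vX vY).1.
  by rewrite (gsym p (nabla X Z p)) //; exact: (tn _ _ vX vZ).1.
by apply/funext => q; rewrite gsym.
Qed.

(** Duality at [E], whose [nabla]-derivative drops out. *)
Lemma nablas_parallel_alpha (R : realType) (n : nat) (M : smoothManifold R n)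
    (Theta : tensor11 R M) (E : vfield R M) (alpha : tensor1 R M)
    (Omega g : tensor2 R M) (nabla nablas : connection R M) :
  vector_field E -> almost_contact_metric Theta E alpha Omega g ->
  linear_connection nablas -> dual_connections g nabla nablas ->
  parallel_field nabla E -> parallel_one_form nablas alpha.
Proof.
move=> vE acm [ts _ _ _] dual pE X Y vX vY p.
have [[_ [gbil gsym _]] _ _ _ _] := acm.
have tsY := (ts X Y vX vY).1 p; have tY := vY.1; have tE := vE.1.
rewrite (alpha_reeb acm) // gsym // -[RHS]add0r.
rewrite -(bilinear0l gbil (tY p)) -(pE X vX p) -dual //.
by congr (X p _); apply/funext => q; rewrite (alpha_reeb acm) // gsym.
Qed.

(** [E] preserves the metric. Since [nabla_E] is the bracket with [E], this is
    the statement that [E] is a Killing field; the vanishing of the Nijenhuis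
    tensor enters only here. *)
Lemma nabla_reeb_metric (R : realType) (d : nat) (M : smoothManifold R d.*2.+1)
    (Omega : tensor2 R M) (alpha : tensor1 R M) (E : vfield R M)
    (g : tensor2 R M) (nabla : connection R M) :
  coKahler Omega alpha E g -> linear_connection nabla -> torsion_free nabla ->
  parallel_field nabla E -> parallel_two_form nabla Omega ->
  forall X Y, vector_field X -> vector_field Y -> forall p,
    E p (fun q => g q (X q) (Y q)) =
    g p (nabla E X p) (Y p) + g p (X p) (nabla E Y p).
Proof.
move=> [[twoO [_ asm] _ cla _] rE [ Theta acm N0]] [tn _ _ _] tf pE pO.
move=> X Y vX vY p.
have [[Obil _] [vE _ aE]] := (twoO, rE).
have [[[tT Tlin vT] [[_ _ gsm] _ _]] T2 TE _ gE] := acm.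
have [_ _ Osm] := Obil.
have brE Z : vector_field Z -> lie_bracket E Z p = nabla E Z p.
  by move=> vZ; rewrite -tf // pE // subr0.
have tE := vE.1; have tX := vX.1; have tY := vY.1.
have vTY := vT _ vY.
have tnX := (tn _ _ vE vX).1 p; have tnY := (tn _ _ vE vY).1 p.
have tnTY := (tn _ _ vE vTY).1 p.
have Ealpha Z : vector_field Z ->
    E p (fun q => alpha q (Z q)) = alpha p (nabla E Z p).
  move=> vZ; have := cla E Z vE vZ p; rewrite /ext_deriv1 brE //.
  rewrite (tangent_const (vZ.1 p) aE) ?subr0; last exact/smooth_on_at/asm.
  by move=> h; lra.
(* [w] is [(nabla_E Theta) Y]. *)
set w : functional R M :=
  nabla E (fun q => Theta q (Y q)) p - Theta p (nabla E Y p).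
have wE : w = (-1) *: Theta p (nabla E Y p)
              + nabla E (fun q => Theta q (Y q)) p.
  by rewrite scaleN1r addrC.
have tTnY := tT p _ tnY.
have tw : tangent p w by rewrite wE; exact: tangent_lincomb.
have Tw : Theta p w = 0.
  have T0 : Theta p 0 = 0.
    by have := T2 p (E p) (tE p); rewrite TE aE scale1r addNr.
  have := N0 E Y vE vY p; rewrite /nijenhuis.
  rewrite lie_bracket0l // lie_bracket0l // T0 !brE // subr0 sub0r wE.
  rewrite Tlin // scaleN1r => h.
  by apply: (can_inj opprK); rewrite oppr0 opprD opprK addrC.
have Ow : Omega p (X p) w = 0 by exact: (Omega_ker_Theta twoO rE acm).
have OTY : Omega p (X p) (nabla E (fun q => Theta q (Y q)) p)
           = Omega p (X p) (Theta p (nabla E Y p)).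
  by apply/eqP; rewrite -subr_eq0 -bilinearBr // Ow.
have Og := pO E X _ vE vX vTY p.
have sa Z : vector_field Z -> smooth_at p (fun q => alpha q (Z q)).
  by move=> vZ; exact/smooth_on_at/asm.
have [_ _ lin leib] := tE p.
have Eaa := leib _ _ (sa X vX) (sa Y vY).
(* The formula for [g] is solved for [alpha X * alpha Y] because linearity of
   [E p] asks for smooth summands, and [Omega] and [g] provide them. *)
have prodE : (fun q => alpha q (X q) * alpha q (Y q)) =
    (fun q => (-1) * Omega q (X q) (Theta q (Y q)) + g q (X q) (Y q)).
  by apply/funext => q; rewrite gE //; ring.
have sO : smooth_at p (fun q => Omega q (X q) (Theta q (Y q))).
  exact/smooth_on_at/(Osm _ _ vX vTY).
have sg : smooth_at p (fun q => g q (X q) (Y q)) by exact/smooth_on_at/gsm.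
move: Eaa; rewrite prodE lin // !Ealpha // => Eaa.
rewrite (gE p (nabla E X p)) // (gE p (X p)) //.
move: Og; rewrite OTY => Og; lra.
Qed.

Lemma subr_swap (V : zmodType) (a b c e : V) :
  a - b = c - e -> c - a = e - b.
Proof.
move=> h; rewrite -(subrK e c) -h addrAC (addrAC a (- b) (- a)) subrr sub0r.
exact: addrC.
Qed.

(** By the total symmetry of [nabla g], the [E]-component of [nablas - nabla]
    is [nabla_E g]. *)
Lemma nabla_parallel_alpha (R : realType) (d : nat)
    (M : smoothManifold R d.*2.+1)
    (Omega : tensor2 R M) (alpha : tensor1 R M) (E : vfield R M)
    (g : tensor2 R M) (nabla nablas : connection R M) :
  coKahler Omega alpha E g -> statistical_shs Omega E g nabla nablas ->
  parallel_one_form nabla alpha.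
Proof.
move=> cK [[ln tf] [ls tfs] dual pE pO] X Y vX vY p.
have [_ [vE _ _] [ Theta acm _]] := cK.
have [[_ [gbil gsym _]] _ _ _ _] := acm.
rewrite (nablas_parallel_alpha vE acm ls dual pE vX vY p).
have [tn _ _ _] := ln; have [ts _ _ _] := ls.
have tnab U V (vU : vector_field U) (vV : vector_field V) :=
  (tn _ _ vU vV).1 p.
have tnas U V (vU : vector_field U) (vV : vector_field V) :=
  (ts _ _ vU vV).1 p.
have tE := vE.1; have tX := vX.1; have tY := vY.1.
pose K U V : functional R M := nablas U V p - nabla U V p.
have Ksym U V : vector_field U -> vector_field V -> K U V = K V U.
  move=> vU vV; apply: subr_swap.
  by rewrite (tf _ _ vU vV) (tfs _ _ vU vV).
(* [g W (K U V) = (nabla_U g) (W, V)] *)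
have gK U V W : vector_field U -> vector_field V -> vector_field W ->
    g p (W p) (K U V) = U p (fun q => g q (W q) (V q))
      - g p (nabla U W p) (V p) - g p (W p) (nabla U V p).
  move=> vU vV vW; have tW := vW.1; have tV := vV.1.
  rewrite bilinearBr //; [|exact: tnas|exact: tnab].
  by rewrite dual //; ring.
have gKsym U V W : vector_field U -> vector_field V -> vector_field W ->
    g p (W p) (K U V) = g p (V p) (K U W).
  move=> vU vV vW; have tW := vW.1; have tV := vV.1.
  rewrite !gK // (gsym p (nabla U W p)) //; last exact: tnab.
  rewrite (gsym p (W p) (nabla U V p)) //; last exact: tnab.
  rewrite addrAC; congr (U p _ - _ - _).
  by apply/funext => q; rewrite gsym.
have gEK : g p (E p) (K X Y) = 0.
  rewrite gKsym // Ksym // gK // gsym //; last exact: tnab.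
  rewrite (nabla_reeb_metric cK ln tf pE pO vY vX) gsym //; last exact: tnab.
  ring.
rewrite !(alpha_reeb acm); [|exact: tnab|exact: tnas].
rewrite gsym //; last exact: tnas.
rewrite [RHS]gsym //; last exact: tnab.
by apply/eqP; rewrite -subr_eq0 -bilinearBr //;
  [exact/eqP|exact: tnas|exact: tnab].
Qed.

(** * Derivatives along a leaf *)

Lemma differential_smooth (R : realType) (k n : nat) (L : smoothManifold R k)
    (M : smoothManifold R n) (i : L -> M) (q : L) (v : functional R L)
    (f : M -> R) : smooth_at (i q) f -> differential i q v f = v (f \o i).
Proof.
by move=> sf; rewrite /differential /restrict_smooth; case: asboolP.
Qed.

Lemma image_tangent_near0 (R : realType) (k n : nat) (L : smoothManifold R k)
    (M : smoothManifold R n) (i : L -> M) (q : L) (v : functional R M)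
    (f : M -> R) :
  image_tangent i q v -> (\forall q' \near q, f (i q') = 0) -> v f = 0.
Proof.
move=> [u tu <-] f0; rewrite /differential /restrict_smooth.
by case: asboolP => // _; exact: (tangent_near0 tu).
Qed.

(** The Leibniz rule for a function that factors only along the submanifold. *)
Lemma image_tangent_leibniz (R : realType) (k n : nat)
    (L : smoothManifold R k) (M : smoothManifold R n) (i : L -> M) (q : L)
    (v : functional R M) (f h r : M -> R) :
  smooth_map i -> image_tangent i q v ->
  smooth_at (i q) f -> smooth_at (i q) h -> smooth_at (i q) r ->
  (\forall q' \near q, r (i q') = f (i q') * h (i q')) ->
  v r = v f * h (i q) + f (i q) * v h.
Proof.
move=> [_ si] [u [germ _ _ leib] <-] sf sh sr rE.
rewrite !differential_smooth // -leib; [exact: germ|exact: si|exact: si].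
Qed.

(** Along the leaf [Y] is [alpha Y *: E], so duality expresses [g (nabla X Y) Z]
    through derivatives of [alpha Y] and [alpha Z] along [X]. As [alpha] is
    parallel for both connections, only [alpha (nabla X Y) * alpha Z] is left.
    The conclusion concerns one connection of the pair, so that exchanging the
    two covers the other. *)
Lemma nabla_ker_two_form (R : realType) (k n : nat) (M : smoothManifold R n)
    (Theta : tensor11 R M) (E : vfield R M) (alpha : tensor1 R M)
    (Omega g : tensor2 R M) (nabla nablas : connection R M)
    (L : smoothManifold R k) (i : L -> M) (X Y : vfield R M) (q : L) :
  one_form alpha -> reeb Omega alpha E ->
  almost_contact_metric Theta E alpha Omega g -> two_form Omega ->
  linear_connection nabla -> linear_connection nablas ->
  dual_connections g nabla nablas ->
  parallel_one_form nabla alpha -> parallel_one_form nablas alpha ->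
  smooth_map i -> vector_field X -> vector_field Y ->
  image_tangent i q (X (i q)) ->
  (\forall q' \near q, ker_two_form Omega (i q') (Y (i q'))) ->
  ker_two_form Omega (i q) (nabla X Y (i q)).
Proof.
move=> [_ asm] rE acm twoO [tn _ _ _] [ts _ _ _] dual pa pas si vX vY iX kY.
have [vE OE _] := rE.
have [[_ [gbil gsym _]] _ _ _ _] := acm; have [_ _ gsm] := gbil.
set p := i q; set U := nabla X Y.
have vU : vector_field U by exact: tn.
have tE := vE.1; have tU := vU.1; have tY := vY.1.
have tsU : tangent p (nablas X U p) by exact: (ts _ _ vX vU).1.
(* [Y z] is [alpha (Y z) *: E z], and [g (E z)] is [alpha z] *)
have gY z w : ker_two_form Omega z (Y z) -> tangent z w ->
    g z (Y z) w = alpha z (Y z) * alpha z w.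
  move=> kYz tw; rewrite (alpha_reeb acm tw).
  by rewrite {1}(ker_two_form_reeb rE acm kYz) bilinearZl // (gsym z w).
(* Duality is tested on [U] itself: a vector at [p] need not be given as the
   value of a global field, but [U p] is, and positivity of [g] asks for no
   other. *)
have guu : g p (U p) (U p) = alpha p (U p) * alpha p (U p).
  have D := dual X Y U vX vY vU p.
  have Lb := @image_tangent_leibniz _ _ _ _ _ i q (X p)
    (fun z => alpha z (Y z)) (fun z => alpha z (U z))
    (fun z => g z (Y z) (U z)) si iX
    (smooth_on_at _ (asm _ vY)) (smooth_on_at _ (asm _ vU))
    (smooth_on_at _ (gsm _ _ vY vU)).
  move: D; rewrite Lb; last first.
    by near=> q'; apply: gY => //; near: q'.
  rewrite -/p (pa X Y) // -/U (pas X U) //.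
  rewrite gY //; last exact: (nbhs_singleton kY).
  by move=> D; lra.
split=> // w tw.
rewrite (reeb_direction rE acm (tU p) guu) bilinearZl ?OE ?mulr0 //.
by case: twoO.
Unshelve. all: by end_near. Qed.

(** * Linear combinations in the kernels *)

Lemma ker_two_form_lincomb (R : realType) (n : nat) (M : smoothManifold R n)
    (Omega : tensor2 R M) (p : M) (a b : R) (v w : functional R M) :
  two_form Omega -> ker_two_form Omega p v -> ker_two_form Omega p w ->
  ker_two_form Omega p (a *: v + b *: w).
Proof.
move=> [Obil _] [tv Ov] [tw Ow]; have [Ol _ _] := Obil.
have tbw : tangent p (b *: w) by exact: tangentZ.
split=> [|x tx]; first exact: tangent_lincomb.
by rewrite Ol // bilinearZl // Ov // Ow // !mulr0 addr0.
Qed.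

Lemma ker_one_form_lincomb (R : realType) (n : nat) (M : smoothManifold R n)
    (alpha : tensor1 R M) (p : M) (a b : R) (v w : functional R M) :
  one_form alpha -> ker_one_form alpha p v -> ker_one_form alpha p w ->
  ker_one_form alpha p (a *: v + b *: w).
Proof.
move=> [alin _] [tv av] [tw aw]; have t0 := tangent0 p.
have tbw : tangent p (b *: w) by exact: tangentZ.
have a0 : alpha p 0 = 0.
  by have := alin p 1 0 0 t0 t0; rewrite scale1r addr0 => h; lra.
split; first exact: tangent_lincomb.
by rewrite alin // -[b *: w]addr0 alin // av aw a0 !mulr0 !addr0.
Qed.

Theorem proposition5p9 (R : realType) (d : nat)
    (M : smoothManifold R d.*2.+1)
    (Omega : tensor2 R M)
    (alpha : tensor1 R M)
    (E : vfield R M)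
    (g : tensor2 R M)
    (nabla nablas : connection R M)
    (HcoK : coKahler Omega alpha E g)
    (Hshs : statistical_shs Omega E g nabla nablas) :
  (forall a : R, leaves_totally_geodesic
     (alpha_connection nabla nablas a) (ker_two_form Omega)) /\
  (forall a : R, leaves_totally_geodesic
     (alpha_connection nabla nablas a) (ker_one_form alpha)).
Proof.
have [[twoO ofa _ _ _] rE [ Theta acm _]] := HcoK.
have [[ln _] [ls _] dual pE _] := Hshs.
have pa := nabla_parallel_alpha HcoK Hshs.
have pas : parallel_one_form nablas alpha.
  by apply: (nablas_parallel_alpha _ acm ls dual pE); case: rE.
have duals : dual_connections g nablas nabla.
  by apply: dual_connections_sym => //; have [[]] := acm.
split=> a k L i [[_ _ [si _ _] iD] _] X Y vX vY q nXY.
- have [iX _] := nbhs_singleton nXY.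
  have kY : \forall q' \near q, ker_two_form Omega (i q') (Y (i q')).
    by apply: filterS nXY => q' [_]; rewrite iD.
  rewrite iD; apply: ker_two_form_lincomb => //.
    exact: (nabla_ker_two_form ofa rE acm twoO ls ln duals).
  exact: (nabla_ker_two_form ofa rE acm twoO ln ls dual).
- have [iX _] := nbhs_singleton nXY.
  have aY0 : X (i q) (fun z => alpha z (Y z)) = 0.
    apply: (image_tangent_near0 iX).
    by apply: filterS nXY => q' [_]; rewrite iD => -[].
  have [tn _ _ _] := ln; have [ts _ _ _] := ls.
  rewrite iD; apply: ker_one_form_lincomb => //; split.
  + exact: (ts _ _ vX vY).1.
  + by rewrite -pas.
  + exact: (tn _ _ vX vY).1.
  + by rewrite -pa.
Qed.
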